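(* Let $M,K,P$ be positive integers with $M\le\min\{P,K\}$, let $p_0>0$, let $\mathbf H\in\mathbb C^{P\times K}$ satisfy $\operatorname{rank}(\mathbf H)\ge M$, and let $\mathbf R_{vv}\in\mathbb C^{P\times P}$ be Hermitian positive definite. Let $\mathbf H^H\mathbf R_{vv}^{-1}\mathbf H=\mathbf V\boldsymbol\Lambda\mathbf V^H$ be an eigenvalue decomposition with $\mathbf V$ unitary and eigenvalues $\lambda_1\ge\cdots\ge\lambda_K\ge0$, and let $\tilde{\mathbf V}_M$ be the first $M$ columns of $\mathbf V$. For $\mathbf F\in\mathbb C^{K\times M}$ with $\operatorname{tr}(\mathbf F\mathbf F^H)\le p_0$ and $\operatorname{rank}(\mathbf H\mathbf F)=M$, and $\mathbf B\in\mathbb C^{M\times M}$ strictly upper triangular, let $\mathbf R_{ee,\rm ZF}(\mathbf F,\mathbf B)$ be the ZF-BDFD error covariance matrix. Then $$|\mathbf R_{ee,\rm ZF}(\mathbf F,\mathbf B)|^{1/M}\ \ge\ \frac{M}{p_0}\Bigl(\prod_{i=1}^M\lambda_i\Bigr)^{-1/M}$$ for all such $(\mathbf F,\mathbf B)$, and equality holds whenever $\mathbf F=\sqrt{p_0/M}\,\tilde{\mathbf V}_M\boldsymbol\Psi$ with $\boldsymbol\Psi$ an arbitrary $M\times M$ unitary matrix. That is, every precoder of this form minimizes the geometric mean-square error of a ZF-BDFD system. In particular this holds for $\boldsymbol\Psi=\boldsymbol\Psi_{\rm ZF}$, any unitary matrix for which the upper-triangular factor in the QR decomposition of $\operatorname{diag}(\lambda_1,\dots,\lambda_M)^{1/2}\boldsymbol\Psi_{\rm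 ZF}$ has equal diagonal entries.
   Context: All matrices are complex; $(\cdot)^H$ is the conjugate transpose, $(\cdot)^+$ the Moore–Penrose pseudo-inverse, $|\cdot|$ the determinant, $\mathbf R_{vv}^{-1/2}$ the inverse of the Hermitian positive definite square root. In a zero-forcing block decision feedback (ZF-BDFD) system with precoder $\mathbf F$ and strictly upper triangular feedback matrix $\mathbf B$, the feedforward matrix is $\mathbf W=(\mathbf B+\mathbf I)(\mathbf R_{vv}^{-1/2}\mathbf H\mathbf F)^+\mathbf R_{vv}^{-1/2}$, which satisfies the zero-forcing condition $\mathbf W\mathbf H\mathbf F=\mathbf B+\mathbf I$. The error covariance matrix (assuming correct past decisions) is $\mathbf R_{ee,\rm ZF}(\mathbf F,\mathbf B)=\mathbf W\mathbf R_{vv}\mathbf W^H$. The geometric mean-square error is $|\mathbf R_{ee,\rm ZF}|^{1/M}$. *)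

(* Defs.v *)
From HB Require Import structures.
From mathcomp Require Import all_boot all_order all_algebra.
From mathcomp Require Import spectral complex.
From mathcomp Require Import classical_sets.

Set Implicit Arguments.
Unset Strict Implicit.
Unset Printing Implicit Defensive.

Import Order.TTheory GRing.Theory Num.Theory.
Local Open Scope ring_scope.
Local Open Scope sesquilinear_scope.

Section Matrices.
Context {C : numClosedFieldType}.

(* The four Penrose equations. *)
Definition is_mpinv m n (A : 'M[C]_(m, n)) (X : 'M[C]_(n, m)) : Prop :=
  [/\ A *m X *m A = A, X *m A *m X = X,
      (A *m X)^t* = A *m X & (X *m A)^t* = X *m A].

(* The default value 0 is never used: see mpinvP and mpinv_unique. *)
Definition mpinv m n (A : 'M[C]_(m, n)) : 'M[C]_(n, m) :=
  xget 0 [set X | is_mpinv A X].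

Definition posdefmx n (A : 'M[C]_n) : Prop :=
  A \is hermsymmx /\ forall x : 'cV[C]_n, x != 0 -> 0 < (x^t* *m A *m x) 0 0.

(* The positive definite square root of a positive definite matrix: see
   sqrtmxP and sqrtmx_unique; the value is irrelevant on other matrices. *)
Definition sqrtmx n (A : 'M[C]_n) : 'M[C]_n :=
  xget 0 [set S | posdefmx S /\ S *m S = A].

Definition strict_utrigmx n (B : 'M[C]_n) : Prop :=
  forall i j : 'I_n, (j <= i)%N -> B i j = 0.

Definition utrigmx n (U : 'M[C]_n) : Prop :=
  forall i j : 'I_n, (j < i)%N -> U i j = 0.

Definition is_QR n (A Q U : 'M[C]_n) : Prop :=
  [/\ Q \is unitarymx, utrigmx U & A = Q *m U].

(* Auxiliary facts showing that mpinv and sqrtmx are well defined. *)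

Lemma adjmxM m n p (A : 'M[C]_(m, n)) (B : 'M[C]_(n, p)) :
  (A *m B)^t* = B^t* *m A^t*.
Proof. by rewrite trmx_mul map_mxM. Qed.

Lemma adjmx1 n : (1%:M : 'M[C]_n)^t* = 1%:M.
Proof. by rewrite trmx1 map_mx1. Qed.

Lemma adjmx_inv n (A : 'M[C]_n) : (invmx A)^t* = invmx (A^t*).
Proof. by rewrite trmx_inv map_invmx. Qed.

Lemma mul_adjmx_ge0 n (u : 'rV[C]_n) : 0 <= (u *m u^t*) 0 0.
Proof. by rewrite mxE sumr_ge0 // => i _; rewrite !mxE mul_conjC_ge0. Qed.

Lemma mul_adjmx_eq0 n (u : 'rV[C]_n) : (u *m u^t*) 0 0 = 0 -> u = 0.
Proof.
rewrite mxE => /eqP; rewrite psumr_eq0; last first.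
  by move=> i _; rewrite !mxE mul_conjC_ge0.
move=> /allP u0; apply/rowP => i; have := u0 i (mem_index_enum _).
by rewrite !mxE mul_conjC_eq0 => /eqP.
Qed.

Lemma row_free_mul_adjmx m n (A : 'M[C]_(m, n)) :
  row_free A -> A *m A^t* \in unitmx.
Proof.
move=> Afree; rewrite -row_free_unit; apply/row_freeP.
suff K0 : kermx (A *m A^t*) = 0.
  by apply/row_freeP; rewrite -kermx_eq0 K0.
apply/row_matrixP => i; rewrite row0; set x := row i _.
have xAA : x *m (A *m A^t*) = 0 by rewrite -row_mul mulmx_ker row0.
have : x *m A = 0.
  by apply: mul_adjmx_eq0; rewrite adjmxM mulmxA -(mulmxA x) xAA mul0mx mxE.
by move=> /eqP; rewrite mulmx_free_eq0 // => /eqP.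
Qed.

Lemma is_mpinv_factor m n r (B : 'M[C]_(m, r)) (D : 'M[C]_(r, n)) :
    row_full B -> row_free D ->
  is_mpinv (B *m D)
    (D^t* *m invmx (D *m D^t*) *m (invmx (B^t* *m B) *m B^t*)).
Proof.
move=> Bfull /row_free_mul_adjmx uD.
have uB : B^t* *m B \in unitmx.
  have /row_free_mul_adjmx : row_free (B^t*).
    by rewrite /row_free mxrank_map mxrank_tr.
  by rewrite trmxCK.
set Di := D^t* *m _; set Bi := _ *m B^t*.
have DDi : D *m Di = 1%:M by rewrite /Di mulmxA mulmxV.
have BiB : Bi *m B = 1%:M by rewrite /Bi -mulmxA mulVmx.
have AX : B *m D *m (Di *m Bi) = B *m Bi.
  by rewrite -mulmxA (mulmxA D) DDi mul1mx.
have XA : (Di *m Bi) *m (B *m D) = Di *m D.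
  by rewrite -mulmxA (mulmxA Bi) BiB mul1mx.
split; rewrite ?AX ?XA.
- by rewrite -mulmxA (mulmxA Bi) BiB mul1mx.
- by rewrite -mulmxA (mulmxA D) DDi mul1mx.
- by rewrite /Bi !adjmxM adjmx_inv adjmxM !trmxCK mulmxA.
- by rewrite /Di !adjmxM adjmx_inv adjmxM !trmxCK mulmxA.
Qed.

Lemma mpinv_exists m n (A : 'M[C]_(m, n)) : exists X, is_mpinv A X.
Proof.
have := is_mpinv_factor (col_base_full A) (row_base_free A).
by rewrite mulmx_base => AX; eexists; exact: AX.
Qed.

Lemma mpinvP m n (A : 'M[C]_(m, n)) : is_mpinv A (mpinv A).
Proof. exact: xgetPex (mpinv_exists A). Qed.

Lemma is_mpinv_inj m n (A : 'M[C]_(m, n)) X Y :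
  is_mpinv A X -> is_mpinv A Y -> X = Y.
Proof.
move=> [AXA XAX hAX hXA] [AYA YAY hAY hYA].
have eAX : A *m X = A *m Y.
  rewrite -hAX -{1}AYA -[A *m Y *m A *m X]mulmxA adjmxM hAX hAY.
  by rewrite mulmxA AXA.
have eXA : X *m A = Y *m A.
  rewrite -hXA -{1}AYA mulmxA [X *m _]mulmxA -mulmxA adjmxM hXA hYA.
  by rewrite -mulmxA [A *m _]mulmxA AXA.
by rewrite -XAX eXA -mulmxA eAX mulmxA YAY.
Qed.

Lemma mpinv_unique m n (A : 'M[C]_(m, n)) X : is_mpinv A X -> X = mpinv A.
Proof. by move=> AX; apply: is_mpinv_inj AX (mpinvP A). Qed.

Lemma hermsymmxP n (A : 'M[C]_n) : reflect (A = A^t*) (A \is hermsymmx).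
Proof.
have -> : (A \is hermsymmx) = (A == A^t*).
  by rewrite is_hermitianmxE expr0 scale1r.
exact: eqP.
Qed.

Lemma posdefmx_diag n (V : 'M[C]_n) (d : 'rV[C]_n) :
  V \is unitarymx -> (forall i, 0 < d 0 i) ->
  posdefmx (V^t* *m diag_mx d *m V).
Proof.
move=> Vu d0; split.
  apply/hermsymmxP; rewrite !adjmxM trmxCK mulmxA tr_diag_mx map_diag_mx.
  congr (_ *m diag_mx _ *m _); apply/rowP => i.
  by rewrite mxE; apply/esym/CrealP/gtr0_real/d0.
move=> x x0; have Vx0 : V *m x != 0.
  apply: contraNneq x0 => Vx0.
  by rewrite -[x](mulKmx (unitarymx_unit Vu)) Vx0 mulmx0.
have -> : x^t* *m (V^t* *m diag_mx d *m V) *m x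
        = (V *m x)^t* *m diag_mx d *m (V *m x).
  by rewrite adjmxM !mulmxA.
move: (V *m x) Vx0 => y y0; rewrite mxE.
have F i : (y^t* *m diag_mx d) 0 i * y i 0 = d 0 i * (y i 0 * (y i 0)^*).
  by rewrite mul_mx_diag !mxE mulrC [_^* * _]mulrC mulrCA.
under eq_bigr do rewrite F.
have [i yi] : exists i, y i 0 != 0.
  apply/existsP; apply: contraNT y0; rewrite negb_exists => /forallP y0.
  by apply/eqP/colP => i; rewrite mxE; have := y0 i; rewrite negbK => /eqP.
rewrite (bigD1 i) //= ltr_wpDr //; last first.
  by rewrite mulr_gt0 // mul_conjC_gt0.
by apply: sumr_ge0 => j _; rewrite mulr_ge0 ?mul_conjC_ge0 // ltW.
Qed.

Lemma sqrtmx_exists n (A : 'M[C]_n) :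
  posdefmx A -> exists S, posdefmx S /\ S *m S = A.
Proof.
move=> [hA pA]; set V := spectralmx A; set d := spectral_diag A.
have Vu : V \is unitarymx by exact: spectral_unitarymx.
have AE : A = V^t* *m diag_mx d *m V.
  have /orthomx_spectralP := hermitian_normalmx hA.
  by rewrite invmx_unitary.
have VV : V *m V^t* = 1%:M by exact/unitarymxP.
have d0 i : 0 < d 0 i.
  have x0 : V^t* *m (delta_mx i 0 : 'cV_n) != 0.
    apply/eqP => /(congr1 (mulmx V)); rewrite mulmxA VV mul1mx mulmx0.
    by move=> /matrixP /(_ i 0); rewrite !mxE !eqxx => /eqP; rewrite oner_eq0.
  have := pA _ x0; rewrite {1}AE adjmxM trmxCK !mulmxA.
  rewrite -(mulmxA _ V) VV mulmx1 -(mulmxA _ V) VV mulmx1.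
  rewrite trmx_delta map_delta_mx -rowE -colE !mxE eqxx mulr1n.
  by [].
exists (V^t* *m diag_mx (map_mx sqrtC d) *m V); split.
  by apply: posdefmx_diag => // i; rewrite mxE sqrtC_gt0.
rewrite !mulmxA -(mulmxA _ V) VV mulmx1 AE; congr (_ *m _).
rewrite -mulmxA mulmx_diag; congr (_ *m diag_mx _); apply/rowP => i.
by rewrite !mxE -expr2 sqrtCK.
Qed.

Lemma sqrtmxP n (A : 'M[C]_n) :
  posdefmx A -> posdefmx (sqrtmx A) /\ sqrtmx A *m sqrtmx A = A.
Proof. by move=> /sqrtmx_exists; exact: xgetPex. Qed.

Lemma psqrtmx_inj n (S T : 'M[C]_n) :
  posdefmx S -> posdefmx T -> S *m S = T *m T -> S = T.
Proof.
move=> [/hermsymmxP hS pS] [/hermsymmxP hT pT] ST.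
pose D := S - T; apply/eqP; rewrite -subr_eq0 -/D.
have hD : D \is hermsymmx.
  by apply/hermsymmxP; rewrite /D !raddfB /= -hS -hT.
have SDT : S *m D + D *m T = 0.
  by rewrite /D mulmxBl mulmxBr ST addrA subrK subrr.
set V := spectralmx D; set d := spectral_diag D.
have Vu : V \is unitarymx by exact: spectral_unitarymx.
have DE : D = V^t* *m diag_mx d *m V.
  have /orthomx_spectralP := hermitian_normalmx hD.
  by rewrite invmx_unitary.
have VV : V *m V^t* = 1%:M by exact/unitarymxP.
suff -> : D = 0 by [].
rewrite DE; suff -> : d = 0 by rewrite linear0 mulmx0 mul0mx.
apply/rowP => i; rewrite mxE.
pose x := V^t* *m (delta_mx i 0 : 'cV_n).
have x0 : x != 0.
  apply/eqP => /(congr1 (mulmx V)); rewrite mulmxA VV mul1mx mulmx0.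
  by move=> /matrixP /(_ i 0); rewrite !mxE !eqxx => /eqP; rewrite oner_eq0.
have Dx : D *m x = d 0 i *: x.
  rewrite DE /x !mulmxA -(mulmxA _ V) VV mulmx1 -mulmxA mul_diag_mx scalemxAr.
  congr (_ *m _); apply/colP => j; rewrite !mxE.
  by case: (j =P i) => [->|]; rewrite ?eqxx ?andbF ?mulr0 //= mulr0.
have d_real : (d 0 i)^* = d 0 i.
  apply/CrealP; have := hermitian_spectral_diag_real hD.
  by move=> /mxOverP; apply.
have xD : x^t* *m D = d 0 i *: x^t*.
  rewrite {1}(hermsymmxP _ hD) -adjmxM Dx linearZ /= map_mxZ.
  by congr (_ *: _); exact: d_real.
have : (x^t* *m (S *m D + D *m T) *m x) 0 0 = 0.
  by rewrite SDT mulmx0 mul0mx mxE.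
clearbody x; rewrite mulmxDr mulmxDl !mulmxA -(mulmxA _ D x) Dx xD -!scalemxAl -scalemxAr.
rewrite -scalerDr mxE => /eqP; rewrite mulf_eq0 => /orP[/eqP //|].
by rewrite mxE gt_eqF // addr_gt0 ?pS ?pT.
Qed.

Lemma sqrtmx_unique n (A S : 'M[C]_n) :
  posdefmx S -> S *m S = A -> S = sqrtmx A.
Proof.
move=> pS SA; have [pT TA] : posdefmx (sqrtmx A) /\ sqrtmx A *m sqrtmx A = A.
  exact: (@xgetPex _ _ [set S | posdefmx S /\ S *m S = A] (ex_intro _ S (conj pS SA))).
by apply: psqrtmx_inj => //; rewrite SA TA.
Qed.

End Matrices.

Section ZeroForcingBDFD.
Context {C : numClosedFieldType} {P K M : nat}.
Variables (p0 : C) (H : 'M[C]_(P, K)) (Rvv : 'M[C]_P).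

Definition zf_feedforward (F : 'M[C]_(K, M)) (B : 'M[C]_M) : 'M[C]_(M, P) :=
  let Rvv_isqrt := invmx (sqrtmx Rvv) in
  (B + 1%:M) *m mpinv (Rvv_isqrt *m H *m F) *m Rvv_isqrt.

Definition zf_errcov (F : 'M[C]_(K, M)) (B : 'M[C]_M) : 'M[C]_M :=
  zf_feedforward F B *m Rvv *m (zf_feedforward F B)^t*.

(* On nonnegative arguments M.-root is the nonnegative real M-th root. *)
Definition zf_gmse (F : 'M[C]_(K, M)) (B : 'M[C]_M) : C :=
  M.-root (\det (zf_errcov F B)).

Definition zf_feasible (F : 'M[C]_(K, M)) (B : 'M[C]_M) : Prop :=
  [/\ \tr (F *m F^t*) <= p0, \rank (H *m F) = M & strict_utrigmx B].

Definition zf_optimal (F : 'M[C]_(K, M)) (B : 'M[C]_M) : Prop :=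
  zf_feasible F B /\
  forall F' B', zf_feasible F' B' -> zf_gmse F B <= zf_gmse F' B'.

End ZeroForcingBDFD.

(* Main.v *)
Require Import Defs.
From HB Require Import structures.
From mathcomp Require Import all_boot all_order all_fingroup all_algebra.
From mathcomp Require Import spectral complex reals.

Set Implicit Arguments.
Unset Strict Implicit.
Unset Printing Implicit Defensive.

(* Writing A = H^H Rvv^-1 H = V D V^H, the zero-forcing feedforward filter gives
   R_ee = (B + I) (F^H A F)^-1 (B + I)^H, and det (B + I) = 1, so the claim is
   that det (F^H A F) is at most (p0 / M)^M times the product of the M largest
   eigenvalues. Put Y = F^H V. By Cauchy-Binet, det (Y D Y^H) is a sum of terms
   |minor of Y|^2 weighted by products of M distinct eigenvalues, hence at most
   the product of the M largest ones times det (Y Y^H); and AM-GM applied to the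
   eigenvalues of Y Y^H, whose trace is tr (F F^H) <= p0, bounds det (Y Y^H) by
   (p0 / M)^M. *)

Import Order.TTheory GRing.Theory Num.Theory.
Local Open Scope ring_scope.
Local Open Scope sesquilinear_scope.

(** * Cauchy-Binet over all maps of indices *)

(** Row [i] of [A *m B] is a combination of the rows of [B] with coefficients [A i k]; this is the
    multilinear expansion, [f] choosing one row of [B] for each [i]. *)
Lemma det_mulmx_rowsub (R : comPzRingType) m n
    (A : 'M[R]_(m, n)) (B : 'M_(n, m)) :
  \det (A *m B) =
  \sum_(f : {ffun 'I_m -> 'I_n}) (\prod_i A i (f i)) * \det (rowsub f B).
Proof.
pose AB (s : 'S_m) i j := A i j * B j (s i).
transitivity (\sum_(f : {ffun 'I_m -> 'I_n}) \sum_(s : 'S_m)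
    (-1) ^+ s * \prod_i AB s i (f i)).
  rewrite exchange_big; apply: eq_bigr => /= s _; rewrite -big_distrr /=.
  congr (_ * _); rewrite -(bigA_distr_bigA (AB s)) /=.
  by apply: eq_bigr => x _; rewrite mxE.
apply: eq_bigr => f _; rewrite big_distrr /=; apply: eq_bigr => s _.
rewrite mulrCA big_split //=; congr (_ * (_ * _)).
by apply: eq_bigr => x _; rewrite mxE.
Qed.

(* Summing over all maps f rather than over increasing ones counts every
   m-subset of indices m! times; noninjective f contribute 0. *)
Lemma Cauchy_Binet_fact (R : comPzRingType) m n
    (A : 'M[R]_(m, n)) (B : 'M_(n, m)) :
  \sum_(f : {ffun 'I_m -> 'I_n}) \det (colsub f A) * \det (rowsub f B) =
  \det (A *m B) *+ m`!.
Proof.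
under eq_bigr do rewrite big_distrl /=.
rewrite exchange_big /= -(card_Sn m) -sumr_const.
apply: eq_big => [s|s _]; first by rewrite inE.
(* For each fixed [s], reindexing [f] by [s^-1] permutes the rows of the second minor; the resulting
   sign cancels the one from the Leibniz formula, so each of the [m!] permutations contributes
   [\det (A *m B)]. *)
pose h (t : 'S_m) (f : {ffun 'I_m -> 'I_n}) := [ffun i => f (t i)].
have hK t : cancel (h t) (h t^-1%g).
  by move=> f; apply/ffunP => i; rewrite !ffunE permKV.
rewrite (reindex_inj (can_inj (hK s^-1%g))) det_mulmx_rowsub /=.
apply: eq_bigr => f _.
have -> : rowsub (h s^-1%g f) B = row_perm s^-1%g (rowsub f B).
  by apply/matrixP => i j; rewrite !mxE ffunE.
rewrite row_permE det_mulmx det_perm odd_permV mulrCA !mulrA -signr_addb addbb.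
by rewrite mul1r; under eq_bigr do rewrite mxE ffunE permK.
Qed.

(** Compare the image [A] of [f] with the set [T] of the first [m] indices. The common part factors
    out, and [A :\: T] and [T :\: A] have equally many elements, separated by the value of [d] at
    the last index of [T]. *)
Lemma prod_antitone_le (R : numDomainType) m n (lemn : (m <= n)%N)
    (d : 'I_n -> R) (f : 'I_m -> 'I_n) :
    (forall i j : 'I_n, (i <= j)%N -> d j <= d i) -> (forall i, 0 <= d i) ->
    injective f ->
  \prod_i d (f i) <= \prod_(i < m) d (widen_ord lemn i).
Proof.
move=> d_dec d_ge0 f_inj; case: m lemn f f_inj => [|m] lemn f f_inj.
  by rewrite !big_ord0.
pose g := widen_ord lemn.
have g_inj : injective g by move=> i j /(congr1 val) /= /val_inj.
pose A := [set f i | i in 'I_m.+1]; pose T := [set g i | i in 'I_m.+1].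
have -> : \prod_i d (f i) = \prod_(k in A) d k.
  by rewrite big_imset //= => i j _ _; exact: f_inj.
have -> : \prod_i d (g i) = \prod_(k in T) d k.
  by rewrite big_imset //= => i j _ _; exact: g_inj.
have cardAT : #|A| = #|T| by rewrite !card_imset.
have mem_T k : (k \in T) = (k < m.+1)%N.
  apply/imsetP/idP => [[i _ ->] //=|lt_k]; exists (Ordinal lt_k) => //.
  exact: val_inj.
rewrite (big_setID T) (big_setID A (A := T)) setIC /= ler_wpM2l //.
  by apply: prodr_ge0.
pose c := d (g ord_max).
have cardD : #|A :\: T| = #|T :\: A|.
  by apply/eqP; rewrite -(eqn_add2l #|A :&: T|) cardsID setIC cardsID cardAT.
apply: (@le_trans _ _ (c ^+ #|A :\: T|)).
  rewrite -prodr_const; apply: ler_prod => k; rewrite !inE mem_T => /andP[kT _].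
  by rewrite d_ge0 d_dec //= ltnW // ltnNge.
rewrite cardD -prodr_const; apply: ler_prod => k.
rewrite !inE mem_T => /andP[_ kT].
by rewrite d_ge0 d_dec.
Qed.

(** * Determinant inequalities for Gram matrices *)

Section Hermitian.
Context {C : numClosedFieldType}.

Lemma det_adjmx n (A : 'M[C]_n) : \det (A^t*) = (\det A)^*.
Proof. by rewrite det_map_mx det_tr. Qed.

Lemma mulmx_adj_diag_ge0 m n (A : 'M[C]_(m, n)) i : 0 <= (A *m A^t*) i i.
Proof.
by rewrite mxE; apply: sumr_ge0 => j _; rewrite !mxE mul_conjC_ge0.
Qed.

Lemma hermsymmx_mul_adj m n (A : 'M[C]_(m, n)) : A *m A^t* \is hermsymmx.
Proof. by apply/hermsymmxP; rewrite adjmxM trmxCK. Qed.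

Lemma det_gram_le m n (Y : 'M[C]_(m, n)) :
  0 <= \det (Y *m Y^t*) <= (\tr (Y *m Y^t*) / m%:R) ^+ m.
Proof.
set N := Y *m _; pose U := spectralmx N; pose d := spectral_diag N.
have Uu : U \is unitarymx by exact: spectral_unitarymx.
have UU : U *m U^t* = 1%:M by exact/unitarymxP.
have NE : N = U^t* *m diag_mx d *m U.
  have /orthomx_spectralP := hermitian_normalmx (hermsymmx_mul_adj Y).
  by rewrite invmx_unitary.
(* Each eigenvalue is a diagonal entry of the Gram matrix of [U *m Y]. *)
have d_ge0 i : 0 <= d 0 i.
  have -> : d 0 i = ((U *m Y) *m (U *m Y)^t*) i i.
    rewrite adjmxM -mulmxA (mulmxA Y) -/N NE !mulmxA UU mul1mx.
    by rewrite -mulmxA UU mulmx1 !mxE eqxx.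
  exact: mulmx_adj_diag_ge0.
have -> : \det N = \prod_i d 0 i.
  by rewrite NE det_mulmx mulrC -det_mulmx mulmxA UU mul1mx det_diag.
have -> : \tr N = \sum_i d 0 i.
  by rewrite NE mxtrace_mulC mulmxA UU mul1mx mxtrace_diag.
rewrite prodr_ge0 //=.
have := @leif_AGM C 'I_m predT (d 0) (fun i _ => d_ge0 i).
by rewrite card_ord => -[].
Qed.

Lemma det_gram_diag_le m n (lemn : (m <= n)%N) (Y : 'M[C]_(m, n)) (d : 'rV_n) :
    (forall i j : 'I_n, (i <= j)%N -> d 0 j <= d 0 i) ->
    (forall i, 0 <= d 0 i) ->
  \det (Y *m diag_mx d *m Y^t*) <=
  (\prod_(i < m) d 0 (widen_ord lemn i)) * \det (Y *m Y^t*).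
Proof.
move=> d_dec d_ge0; set c := \prod_(i < m) _.
have c_ge0 : 0 <= c by apply: prodr_ge0.
have adj_rowsub (f : {ffun 'I_m -> 'I_n}) : rowsub f (Y^t*) = (colsub f Y)^t*.
  by apply/matrixP => i j; rewrite !mxE.
have det_colsub (f : {ffun 'I_m -> 'I_n}) :
    \det (colsub f (Y *m diag_mx d)) = (\prod_i d 0 (f i)) * \det (colsub f Y).
  have -> : colsub f (Y *m diag_mx d) =
            colsub f Y *m diag_mx (\row_i d 0 (f i)).
    by apply/matrixP => i j; rewrite !mul_mx_diag !mxE.
  by rewrite det_mulmx det_diag mulrC; under eq_bigr do rewrite mxE.
(* Scaling by [m!] turns both sides into Cauchy-Binet sums, which are compared term by term. *)
rewrite -(ler_pMn2r (fact_gt0 m)) -mulrnAr -!Cauchy_Binet_fact mulr_sumr.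
apply: ler_sum => f _; rewrite adj_rowsub det_colsub det_adjmx -mulrA.
have [/injectiveP f_inj|/injectivePn[i [j neq_ij eq_f]]] :=
  boolP (injectiveb f).
  by rewrite ler_wpM2r ?mul_conjC_ge0 // prod_antitone_le.
(* A noninjective [f] repeats a column, so both terms vanish. *)
suff -> : \det (colsub f Y) = 0 by rewrite !mul0r !mulr0.
rewrite -det_tr; apply: (determinant_alternate neq_ij) => k.
by rewrite !mxE eq_f.
Qed.

Lemma posdefmx_unit n (A : 'M[C]_n) : posdefmx A -> A \in unitmx.
Proof.
move=> [_ A_gt0]; rewrite -row_free_unit; apply: inj_row_free => x xA0.
apply/eqP/negPn/negP => x_neq0.
have : x^t* != 0.
  by apply: contraNneq x_neq0 => x0; rewrite -[x]trmxCK x0 trmx0 map_mx0.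
by move=> /A_gt0; rewrite trmxCK xA0 mul0mx mxE ltxx.
Qed.

Lemma mpinv_row_full m n (A : 'M[C]_(m, n)) :
  row_full A -> mpinv A = invmx (A^t* *m A) *m A^t*.
Proof.
move=> A_full; apply/esym/mpinv_unique.
have := @is_mpinv_factor C _ _ _ A 1%:M A_full.
by rewrite row_free_unit unitmx1 adjmx1 !mulmx1 invmx1 !mul1mx; apply.
Qed.

Lemma gram_unit m n (A : 'M[C]_(m, n)) : row_full A -> A^t* *m A \in unitmx.
Proof.
move=> A_full; have /row_free_mul_adjmx : row_free (A^t*).
  by rewrite /row_free mxrank_map mxrank_tr.
by rewrite trmxCK.
Qed.

Lemma det_strict_utrig_add1 n (B : 'M[C]_n) :
  strict_utrigmx B -> \det (B + 1%:M) = 1.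
Proof.
move=> B_utrig; rewrite -det_tr det_trig.
  by rewrite big1 // => i _; rewrite !mxE B_utrig // eqxx add0r.
apply/is_trig_mxP => i j lt_ij.
by rewrite !mxE B_utrig 1?ltnW // add0r -val_eqE gtn_eqF.
Qed.

End Hermitian.

Section Optimality.
Context {C : numClosedFieldType} {M K P : nat} (leMK : (M <= K)%N).
Variables (p0 : C) (H : 'M[C]_(P, K)) (Rvv : 'M[C]_P).
Variables (V : 'M[C]_K) (d : 'rV[C]_K).
Hypothesis M_gt0 : (0 < M)%N.
Hypothesis p0_gt0 : 0 < p0.
Hypothesis Rvv_pos : posdefmx Rvv.
Hypothesis rankH : (M <= \rank H)%N.
Hypothesis V_unitary : V \is unitarymx.
Hypothesis eigdec : H^t* *m invmx Rvv *m H = V *m diag_mx d *m V^t*.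
Hypothesis d_dec : forall i j : 'I_K, (i <= j)%N -> d 0 j <= d 0 i.
Hypothesis d_ge0 : forall i, 0 <= d 0 i.

Let S := sqrtmx Rvv.
Let A := H^t* *m invmx Rvv *m H.
Let top (i : 'I_M) : 'I_K := widen_ord leMK i.
Let VM : 'M[C]_(K, M) := colsub top V.

(** * Noise whitening and the error determinant *)

(** Since [S] is Hermitian with square [Rvv], whitening by [invmx S] turns forms weighted by
    [invmx Rvv] into ordinary Gram matrices. *)
Lemma whitened_mul_adj n (X : 'M[C]_(P, n)) :
  (invmx S *m X)^t* *m (invmx S *m X) = X^t* *m invmx Rvv *m X.
Proof.
have [S_pos SS] := sqrtmxP Rvv_pos; have /posdefmx_unit S_unit := S_pos.
have [/hermsymmxP hS _] := S_pos.
have -> : invmx Rvv = invmx S *m invmx S.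
  rewrite -[RHS]mulmx1 -(mulmxV (posdefmx_unit Rvv_pos)).
  rewrite -[X in X *m invmx Rvv]SS.
  by rewrite -/S !mulmxA mulmxKV // mulVmx // mul1mx.
by rewrite adjmxM adjmx_inv -hS !mulmxA.
Qed.

Lemma whitened_row_full n (X : 'M[C]_(P, n)) :
  \rank X = n -> row_full (invmx S *m X).
Proof.
move=> rankX; have [/posdefmx_unit S_unit _] := sqrtmxP Rvv_pos.
by rewrite /row_full eqmxMfull ?rankX // row_full_unit unitmx_inv.
Qed.

Lemma whitened_gram (F : 'M[C]_(K, M)) :
  (invmx S *m H *m F)^t* *m (invmx S *m H *m F) = F^t* *m A *m F.
Proof. by rewrite -mulmxA whitened_mul_adj adjmxM /A !mulmxA. Qed.

(** With [G = invmx S *m H *m F], the noise covariance becomes the identity after whitening; full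
    column rank of [G] then makes the product of its pseudo-inverse with the adjoint of that inverse
    equal to [invmx (G^t* *m G)]. *)
Lemma det_zf_errcov (F : 'M[C]_(K, M)) (B : 'M[C]_M) :
    \rank (H *m F) = M -> strict_utrigmx B ->
  \det (zf_errcov H Rvv F B) = (\det (F^t* *m A *m F))^-1.
Proof.
move=> rankHF B_utrig; rewrite /zf_errcov /zf_feedforward -/S.
have [S_pos SS] := sqrtmxP Rvv_pos; have /posdefmx_unit S_unit := S_pos.
have [/hermsymmxP hS _] := S_pos; rewrite -/S in SS S_unit hS.
have := whitened_gram F; set G := invmx S *m H *m F => GG.
have G_full : row_full G by rewrite /G -mulmxA whitened_row_full.
clearbody G; rewrite -GG !adjmxM adjmx_inv -hS -[X in _ *m X *m _]SS !mulmxA.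
rewrite mulmxKV // mulmxK //.
rewrite mpinv_row_full // adjmxM adjmx_inv adjmxM trmxCK.
rewrite !mulmxA -[_ *m G^t* *m G]mulmxA mulmxKV ?gram_unit //.
rewrite !det_mulmx det_inv det_adjmx.
by rewrite det_strict_utrig_add1 // conjC1 mul1r mulr1.
Qed.

Lemma det_eff_gt0 (F : 'M[C]_(K, M)) :
  \rank (H *m F) = M -> 0 < \det (F^t* *m A *m F).
Proof.
move=> /whitened_row_full; rewrite mulmxA => G_full.
rewrite -whitened_gram lt_def -unitfE -unitmxE gram_unit //=.
have /andP[+ _] := det_gram_le ((invmx S *m H *m F)^t*).
by rewrite trmxCK.
Qed.

(** * The lower bound and its attainment *)

Lemma det_eff_le (F : 'M[C]_(K, M)) :
    \tr (F *m F^t*) <= p0 ->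
  \det (F^t* *m A *m F) <= (\prod_i d 0 (top i)) * (p0 / M%:R) ^+ M.
Proof.
move=> trF; have /unitarymxP VV := V_unitary.
have -> : F^t* *m A *m F = (F^t* *m V) *m diag_mx d *m (F^t* *m V)^t*.
  by rewrite /A eigdec adjmxM trmxCK !mulmxA.
apply: le_trans (det_gram_diag_le leMK _ d_dec d_ge0) _.
apply: ler_wpM2l; first by apply: prodr_ge0.
have /andP[_ le_det] := det_gram_le (F^t* *m V).
have eq_tr : \tr ((F^t* *m V) *m (F^t* *m V)^t*) = \tr (F *m F^t*).
  by rewrite adjmxM trmxCK mulmxA -(mulmxA _ V) VV mulmx1 mxtrace_mulC.
have tr_ge0 : 0 <= \tr ((F^t* *m V) *m (F^t* *m V)^t*).
  by apply: sumr_ge0 => i _; exact: mulmx_adj_diag_ge0.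
apply: le_trans le_det _; apply: lerXn2r.
- by rewrite qualifE /= divr_ge0.
- by rewrite qualifE /= divr_ge0 ?ler0n ?(ltW p0_gt0).
- by rewrite ler_wpM2r ?invr_ge0 // eq_tr.
Qed.

(** If this eigenvalue vanished, so would all later ones. The columns of [Y = invmx S *m H *m V]
    have squared norms [d], so [Y] would have rank at most [i < M], whereas its rank is that of
    [H]. *)
Lemma eig_top_gt0 (i : 'I_M) : 0 < d 0 (top i).
Proof.
rewrite lt_def d_ge0 andbT; apply/negP => /eqP di0.
have [S_pos _] := sqrtmxP Rvv_pos; have /posdefmx_unit S_unit := S_pos.
pose Y := invmx S *m H *m V.
have YY : Y^t* *m Y = diag_mx d.
  rewrite /Y -[_ *m H *m V]mulmxA whitened_mul_adj adjmxM.
  have -> : V^t* *m H^t* *m invmx Rvv *m (H *m V) =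
            V^t* *m (H^t* *m invmx Rvv *m H) *m V by rewrite !mulmxA.
  rewrite eigdec.
  have /unitarymxP VV := V_unitary.
  by rewrite !mulmxA (mulmx1C VV) mul1mx -mulmxA (mulmx1C VV) mulmx1.
have rankY : \rank Y = \rank H.
  rewrite mxrankMfree ?row_free_unit ?unitarymx_unit //.
  by rewrite eqmxMfull // row_full_unit unitmx_inv.
clearbody Y; have Ycol0 (k : 'I_K) : (i <= k)%N -> col k Y = 0.
  move=> le_ik; have dk0 : d 0 k = 0.
    by apply/eqP; rewrite eq_le d_ge0 andbT -di0 d_dec.
  have /(congr1 (fun Z => Z^t*)) : (col k Y)^t* = 0.
    apply: mul_adjmx_eq0; rewrite trmxCK.
    have := congr1 (fun Z : 'M__ => Z k k) YY.
    rewrite [RHS]mxE eqxx dk0 => YYk; rewrite -[RHS]YYk !mxE.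
    by apply: eq_bigr => j _; rewrite !mxE.
  by rewrite trmxCK trmx0 map_mx0.
have : (\rank Y <= i)%N.
  (* Columns from [i] on are zero, so truncating to the first [i] columns leaves [Y] unchanged and
     bounds its rank. *)
  have -> : Y = Y *m pid_mx i.
    apply/matrixP => a b; rewrite mxE (bigD1 b) //= big1 ?addr0; last first.
      by move=> j /negPf neq_jb; rewrite mxE (inj_eq val_inj) neq_jb mulr0.
    rewrite mxE eqxx /=; have [lt_bi|le_ib] := ltnP b i; first by rewrite mulr1.
    by rewrite mulr0; have /colP/(_ a) := Ycol0 _ le_ib; rewrite !mxE.
  apply: leq_trans (mxrankM_maxr _ _) _.
  by rewrite rank_pid_mx // (leq_trans (ltnW (ltn_ord i)) leMK).
by rewrite rankY leqNgt (leq_trans (ltn_ord i)).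
Qed.

Definition zf_bound : C := (M%:R / p0) * (M.-root (\prod_i d 0 (top i)))^-1.

(** Placing everything under one root allows a direct comparison with the inverse determinant
    bounded through [det_eff_le]. *)
Lemma zf_boundE :
  zf_bound = M.-root ((\prod_i d 0 (top i)) * (p0 / M%:R) ^+ M)^-1.
Proof.
have prod_ge0 : 0 <= \prod_i d 0 (top i) by apply: prodr_ge0.
have q_ge0 : 0 <= p0 / M%:R by rewrite divr_ge0 ?ler0n ?(ltW p0_gt0).
rewrite rootCV ?mulr_ge0 ?exprn_ge0 // rootCMl // exprCK // invfM invf_div.
by rewrite mulrC.
Qed.

Lemma zf_bound_le (F : 'M[C]_(K, M)) (B : 'M[C]_M) :
  zf_feasible p0 H F B -> zf_bound <= zf_gmse H Rvv F B.
Proof.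
move=> [trF rankHF B_utrig]; rewrite zf_boundE /zf_gmse det_zf_errcov //.
have det_gt0 := det_eff_gt0 rankHF; have det_le := det_eff_le trF.
have lb_gt0 := lt_le_trans det_gt0 det_le.
by rewrite ler_rootC ?lef_pV2 // qualifE /= invr_ge0 ltW.
Qed.

(** Here [F^t* *m A *m F] is [p0 / M] times a unitary conjugate of the diagonal of top eigenvalues,
    so [det_eff_le] is an equality. The scalar [c] is fixed only up to phase. *)
Lemma zf_precoder_opt (c : C) (Psi B : 'M[C]_M) :
    c * c^* = p0 / M%:R -> Psi \is unitarymx -> strict_utrigmx B ->
  let F := c *: (VM *m Psi) in
  zf_optimal p0 H Rvv F B /\ zf_gmse H Rvv F B = zf_bound.
Proof.
move=> cc Psi_unitary B_utrig F.
have /unitarymxP PP := Psi_unitary; have /unitarymxP VV := V_unitary.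
(* [E] embeds the first [M] coordinates; [E^t* *m X *m E] is the leading block of [X]. *)
pose E : 'M[C]_(K, M) := colsub top 1%:M.
have VME : VM = V *m E by rewrite /E mulmx_colsub mulmx1.
have top_inj : injective top by move=> i j /(congr1 val) /= /val_inj.
have EXE (X : 'M[C]_K) : E^t* *m X *m E = mxsub top top X.
  have -> : E^t* = rowsub top 1%:M.
    by apply/matrixP => i j; rewrite !mxE eq_sym conjC_nat.
  by rewrite mul_rowsub_mx mul1mx mulmx_colsub mulmx1 -mxsub_comp.
have EE : E^t* *m E = 1%:M.
  rewrite -[E^t*]mulmx1 EXE; apply/matrixP => i j.
  by rewrite !mxE (inj_eq top_inj).
have EDE : E^t* *m diag_mx d *m E = diag_mx (\row_i d 0 (top i)).
  by rewrite EXE; apply/matrixP => i j; rewrite !mxE (inj_eq top_inj).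
have F_adj : F^t* = c^* *: (Psi^t* *m (E^t* *m V^t*)).
  by rewrite /F linearZ /= map_mxZ VME !adjmxM.
have FAF : F^t* *m A *m F =
    (p0 / M%:R) *: (Psi^t* *m diag_mx (\row_i d 0 (top i)) *m Psi).
  rewrite F_adj /A eigdec /F VME -!scalemxAl -scalemxAr scalerA mulrC cc.
  congr (_ *: _); rewrite -EDE !mulmxA.
  rewrite -(mulmxA _ (V^t*) V) (mulmx1C VV) mulmx1.
  by rewrite -(mulmxA _ (V^t*) V) (mulmx1C VV) mulmx1.
have det_FAF :
    \det (F^t* *m A *m F) = (\prod_i d 0 (top i)) * (p0 / M%:R) ^+ M.
  rewrite FAF detZ det_mulmx mulrC; congr (_ * _).
  rewrite mulrC -det_mulmx mulmxA PP mul1mx det_diag.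
  by apply: eq_bigr => i _; rewrite mxE.
have F_feasible : zf_feasible p0 H F B.
  split=> //.
    rewrite mxtrace_mulC F_adj /F VME -scalemxAl -scalemxAr scalerA mulrC cc.
    rewrite !mulmxA -(mulmxA _ (V^t*) V) (mulmx1C VV) mulmx1.
    rewrite -(mulmxA _ (E^t*) E) EE mulmx1 (mulmx1C PP) mxtraceZ mxtrace1.
    by rewrite divfK // pnatr_eq0 -lt0n.
  apply/eqP; rewrite eqn_leq rank_leq_col /=.
  (* This invertible matrix factors through [H *m F], which forces the rank of [H *m F] to be at
     least [M]. *)
  have FAF_unit : F^t* *m A *m F \in unitmx.
    rewrite unitmxE det_FAF unitfE mulf_neq0 ?expf_neq0 //.
      by apply/prodf_neq0 => i _; rewrite gt_eqF ?eig_top_gt0.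
    by rewrite mulf_neq0 ?invr_eq0 ?pnatr_eq0 -?lt0n ?gt_eqF.
  rewrite -{1}(mxrank_unit FAF_unit) /A -!mulmxA.
  rewrite (mulmxA _ (invmx _)) mulmxA; exact: mxrankM_maxr.
have gmseE : zf_gmse H Rvv F B = zf_bound.
  case: F_feasible => _ rankHF _.
  by rewrite /zf_gmse det_zf_errcov // det_FAF zf_boundE.
by split=> //; split=> // F' B' feas'; rewrite gmseE zf_bound_le.
Qed.

End Optimality.

(** * Specialization to complex matrices with real spectrum and power *)

Local Open Scope complex_scope.

Theorem mainTheorem3 (R : realType) (M K P : nat)
    (M_gt0 : (0 < M)%N) (K_gt0 : (0 < K)%N) (P_gt0 : (0 < P)%N)
    (leMP : (M <= P)%N) (leMK : (M <= K)%N)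
    (p0 : R) (p0_gt0 : 0 < p0)
    (H : 'M[R[i]]_(P, K)) (rankH : (M <= \rank H)%N)
    (Rvv : 'M[R[i]]_P) (Rvv_pos : posdefmx Rvv)
    (V : 'M[R[i]]_K) (V_unitary : V \is unitarymx)
    (lambda : 'I_K -> R)
    (eigdec : H^t* *m invmx Rvv *m H =
              V *m diag_mx (\row_(k < K) (lambda k)%:C) *m V^t*)
    (lambda_dec : forall i j : 'I_K, (i <= j)%N -> lambda j <= lambda i)
    (lambda_ge0 : forall k : 'I_K, 0 <= lambda k) :
  let top (i : 'I_M) : 'I_K := widen_ord leMK i in
  let VM : 'M[R[i]]_(K, M) := colsub top V in
  let bound : R[i] :=
    (M%:R / p0)%:C * (M.-root (\prod_(i < M) (lambda (top i))%:C))^-1 in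
  let precoder (Psi : 'M[R[i]]_M) : 'M[R[i]]_(K, M) :=
    (Num.sqrt (p0 / M%:R))%:C *: (VM *m Psi) in
  [/\ forall (F : 'M[R[i]]_(K, M)) (B : 'M[R[i]]_M),
        zf_feasible p0%:C H F B -> bound <= zf_gmse H Rvv F B,
      forall (Psi : 'M[R[i]]_M) (B : 'M[R[i]]_M),
        Psi \is unitarymx -> strict_utrigmx B ->
        zf_optimal p0%:C H Rvv (precoder Psi) B /\
        zf_gmse H Rvv (precoder Psi) B = bound
    & forall (PsiZF Q U : 'M[R[i]]_M) (B : 'M[R[i]]_M),
        PsiZF \is unitarymx ->
        is_QR (diag_mx (\row_(i < M) (Num.sqrt (lambda (top i)))%:C) *m PsiZF)
              Q U ->
        (forall i j : 'I_M, U i i = U j j) -> strict_utrigmx B ->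
        zf_optimal p0%:C H Rvv (precoder PsiZF) B /\
        zf_gmse H Rvv (precoder PsiZF) B = bound].
Proof.
move=> top VM bound precoder.
pose d : 'rV[R[i]]_K := \row_k (lambda k)%:C.
have d_dec (i j : 'I_K) : (i <= j)%N -> d 0 j <= d 0 i.
  by move=> le_ij; rewrite !mxE lecR lambda_dec.
have d_ge0 i : 0 <= d 0 i by rewrite mxE lecR.
have p0C_gt0 : 0 < p0%:C by rewrite ltcR.
have boundE : bound = zf_bound leMK p0%:C d.
  rewrite /bound /zf_bound rmorphM /= fmorphV rmorph_nat.
  by congr (_ * (M.-root _)^-1); apply: eq_bigr => i _; rewrite mxE.
have optimal (Psi B : 'M[R[i]]_M) :
    Psi \is unitarymx -> strict_utrigmx B ->
    zf_optimal p0%:C H Rvv (precoder Psi) B /\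
    zf_gmse H Rvv (precoder Psi) B = bound.
  rewrite boundE; apply: zf_precoder_opt => //.
  (* The scaling factor is real, so its squared modulus is its square, [p0 / M]. *)
  rewrite conj_Creal ?ger0_real ?lecR ?sqrtr_ge0 //.
  rewrite -rmorphM /= -expr2 sqr_sqrtr ?divr_ge0 ?ler0n ?ltW //.
  by rewrite rmorphM /= fmorphV rmorph_nat.
split=> [F B F_feasible|Psi B|Psi Q U B Psi_unitary _ _]; last 2 first.
- exact: optimal.
- exact: optimal.
rewrite boundE.
by apply: (zf_bound_le leMK M_gt0 p0C_gt0 Rvv_pos V_unitary eigdec d_dec d_ge0).
Qed.
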